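(* Let $g$ be a positive integer and let $p$ be a prime number with $p\equiv 1\pmod g$. Then there exists a subset $A\subseteq\mathbb{Z}_{(p^2-p)/g}$ with $|A|=p-1$ such that $A\in B_2[g]\big(\mathbb{Z}_{(p^2-p)/g}\big)$.
   Context: $\mathbb{Z}_N$ denotes the additive cyclic group of integers modulo $N$. For an additive abelian group $G$, a subset $A\subseteq G$ and positive integers $h\ge 2$, $g$, we write $A\in B_h[g](G)$ if every $b\in G$ has at most $g$ distinct representations $b=a_1+\cdots+a_h$ with $a_1,\dots,a_h\in A$, counted up to reordering of the summands. *)

(* Defs.v *)
From mathcomp Require Import all_boot all_algebra.

Set Implicit Arguments.
Unset Strict Implicit.
Unset Printing Implicit Defensive.

Import GRing.Theory.
Local Open Scope ring_scope.

Definition is_representation (G : zmodType) (A : {pred G}) (h : nat) (b : G)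
    (t : h.-tuple G) : bool :=
  all (mem A) t && (\sum_(a <- t) a == b).

(* A \in B_h[g](G). Representations are h-tuples taken up to permutation, so
   "at most g distinct representations" bounds the length of every list of
   representations no two of which are permutations of one another. This makes
   sense for infinite G as well. *)
Definition is_Bhg (G : zmodType) (h g : nat) (A : {pred G}) : Prop :=
  forall (b : G) (s : seq (h.-tuple G)),
    all (is_representation A b) s ->
    pairwise (fun t u : h.-tuple G => ~~ perm_eq t u) s ->
    (size s <= g)%N.

(* 'Z_N is the integers modulo N only when N > 1; this always holds for
   N = (p^2 - p) / g. *)
Lemma modulus_gt1 (g p : nat) :
  (0 < g)%N -> prime p -> p = 1 %[mod g] -> (1 < (p ^ 2 - p) %/ g)%N.
Proof.
move=> g0 pp /eqP; rewrite eqn_mod_dvd ?prime_gt0 // => gp.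
have -> : (p ^ 2 - p = p * (p - 1))%N by rewrite mulnBr muln1 expnS expn1.
rewrite -muln_divA // (leq_trans (prime_gt1 pp)) // leq_pmulr //.
by rewrite divn_gt0 // dvdn_leq // subn_gt0 prime_gt1.
Qed.

(* Main.v *)
(** Let [q] be a primitive root modulo [p] and [m = (p - 1) / g]. By the
Chinese remainder theorem there is, for each [x < p - 1], an element [a] of
[Z_(p m)] with [a = x] mod [m] and [a = q^x] mod [p] (Ruzsa's construction).
The residue [u] of [a] mod [p] satisfies [u ^ g = q ^ (g a)], so if
[a + a' = b] then the product of the residues of [a] and [a'] is one of the at
most [g] roots of [X^g - q^(g b)]. The residues also have sum [b] mod [p], and
two elements of a field are determined up to order by their sum and product. *)
Require Import Defs.
From mathcomp Require Import all_boot all_algebra cyclic finfield.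
From mathcomp Require Import ring.

Section RuzsaSet.

Set Implicit Arguments.
Unset Strict Implicit.

Import GRing.Theory.
Local Open Scope ring_scope.

(** Abstract form of the count: [u] will be reduction modulo [p] and [chi a] will be [q ^+ (g * a)].
    The two are tied together on [A] only. *)
Lemma is_B2g_of_power_character (G : zmodType) (F : idomainType)
    (A : {pred G}) (g : nat) (u chi : G -> F) :
  (0 < g)%N -> {in A &, injective u} -> {morph u : a b / a + b} ->
  {morph chi : a b / a + b >-> a * b} -> {in A, forall a, u a ^+ g = chi a} ->
  is_Bhg 2 g A.
Proof.
move=> g_gt0 u_inj uD chiM uX b s /allP s_rep s_pw.
pose key (t : 2.-tuple G) := \prod_(a <- t) u a.
have key_inj : {in s &, forall t t', key t = key t' -> perm_eq t t'}.
  move=> [[|x [|y []]] //= i] [[|x' [|y' []]] //= j] /s_rep + /s_rep.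
  rewrite /is_representation /key /= !big_cons !big_nil !mulr1 !addr0.
  move=> /andP[/and3P[xA yA _] /eqP eb] /andP[/and3P[xA' yA' _] /eqP eb'] exy.
  have us : u x + u y = u x' + u y' by rewrite -!uD eb eb'.
  (* Equal sums and products make [u x] a root of the quadratic with roots [u x'] and [u y']. *)
  have : (u x - u x') * (u x - u y') = 0.
    have -> : (u x - u x') * (u x - u y') =
      u x * (u x + u y - (u x' + u y')) - (u x * u y - u x' * u y') by ring.
    by rewrite us exy !subrr mulr0 subr0.
  move/eqP; rewrite mulf_eq0 !subr_eq0.
  case/orP=> /eqP /u_inj ex; move: us; rewrite ex //.
    by move/addrI/u_inj => ->.
  rewrite [RHS]addrC => /addrI/u_inj -> //.
  exact/permPl/(perm_catC [:: y'] [:: x']).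
have s_uniq : uniq (map key s).
  rewrite uniq_pairwise pairwise_map.
  apply: sub_in_pairwise s_pw => [t t' ts ts'|]; last exact: allss.
  by apply: contraNneq; exact: key_inj.
(* The keys are distinct roots of ['X^g - (chi b)%:P], a polynomial of size [g.+1]. *)
rewrite -ltnS -(size_map key) -(size_XnsubC (chi b) g_gt0).
apply: max_poly_roots => //; first by rewrite -size_poly_gt0 size_XnsubC.
apply/allP => _ /mapP[[[|x [|y []]] //= i] /s_rep + ->].
rewrite /is_representation /key /= !big_cons !big_nil mulr1 addr0.
move=> /andP[/and3P[xA yA _] /eqP <-].
by rewrite rootE !hornerE exprMn !uX // chiM subrr.
Qed.

Lemma val_ZpD (N d : nat) (a b : 'Z_N) :
  (1 < N)%N -> (d %| N)%N -> ((a + b)%R = a + b %[mod d])%N.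
Proof. by move=> N_gt1 dN; rewrite /= modn_dvdm ?Zp_cast. Qed.

(** By Fermat, the [p.-1] nonzero residues all satisfy [x ^+ p.-1 = 1]; that many distinct roots of
    unity in a field include a primitive one. *)
Lemma Fp_has_prim_root (p : nat) :
  prime p -> exists q : 'F_p, p.-1.-primitive_root q.
Proof.
move=> p_pr; pose rs := enum (predC1 (0 : 'F_p)).
have : has p.-1.-primitive_root rs.
  apply: has_prim_root; rewrite ?enum_uniq //.
  - by rewrite -ltnS prednK ?prime_gt1 ?prime_gt0.
  - apply/allP => x; rewrite mem_enum !inE => x0; apply/unity_rootP.
    apply: (mulfI x0); rewrite mulr1 -exprS prednK ?prime_gt0 //.
    by rewrite -[p in x ^+ p](card_Fp p_pr) expf_card.
  - by rewrite -cardE cardC1 card_Fp.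
by case/hasP => q _ qP; exists q.
Qed.

Lemma Fp_eq_nat (p m n : nat) :
  prime p -> (m = n %[mod p])%N -> m%:R = n%:R :> 'F_p.
Proof. by move=> p_pr e; rewrite -Fp_nat_mod // e Fp_nat_mod. Qed.

(** [q ^+ g] has order [m], so its powers are unaffected by the wrap-around of addition in
    ['Z_(p * m)]. *)
Lemma prim_expr_eq (p g m x y : nat) (q : 'F_p) :
  p.-1.-primitive_root q -> (m * g = p.-1)%N -> (x = y %[mod m])%N ->
  q ^+ (g * x) = q ^+ (g * y).
Proof.
move=> qP mg exy; apply/eqP; rewrite (eq_prim_root_expr qP) -mg (mulnC m).
by rewrite -!muln_modr exy.
Qed.

Lemma exists_B2g (p g m : nat) : prime p -> (0 < g)%N -> (m * g = p.-1)%N ->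
  exists A : {set 'Z_(p * m)}, #|A| = p.-1 /\ is_Bhg 2 g A.
Proof.
move=> p_pr g_gt0 mg; have [q qP] := Fp_has_prim_root p_pr.
have p1_gt0 : (0 < p.-1)%N by rewrite -ltnS prednK ?prime_gt1 ?prime_gt0.
have m_gt0 : (0 < m)%N by move: p1_gt0; rewrite -mg muln_gt0 => /andP[].
have N_gt1 : (1 < p * m)%N by rewrite (leq_trans (prime_gt1 p_pr)) ?leq_pmulr.
have co : coprime p m.
  by apply: (coprime_dvdr (dvdn_mulr g (dvdnn m))); rewrite mg coprimenP ?prime_gt0.
pose f (x : 'I_p.-1) : 'Z_(p * m) := (chinese p m (q ^+ x : 'F_p) x)%:R.
pose u (a : 'Z_(p * m)) : 'F_p := (a : nat)%:R.
have uf x : u (f x) = q ^+ x.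
  rewrite -[RHS]natr_Zp; apply: Fp_eq_nat => //.
  by rewrite val_Zp_nat // modn_dvdm ?dvdn_mulr // chinese_modl.
have fm x : (f x = x %[mod m])%N.
  by rewrite val_Zp_nat // modn_dvdm ?dvdn_mull // chinese_modr.
(* As [x < p.-1], the residue modulo [p] alone determines [x]. This gives both the size of the set
   and the injectivity of [u] on it. *)
have uf_inj : injective (u \o f).
  move=> x y /eqP; rewrite /= !uf (eq_prim_root_expr qP) !modn_small //.
  by move/eqP/val_inj.
exists (f @: setT); split.
  by rewrite card_imset ?cardsT ?card_ord //; exact: inj_compr uf_inj.
apply: (@is_B2g_of_power_character _ _ _ _ u (fun a => q ^+ (g * a))) => //.
- by move=> _ _ /imsetP[x _ ->] /imsetP[y _ ->] /uf_inj ->.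
- by move=> a b; rewrite /u -natrD; apply: Fp_eq_nat; rewrite ?val_ZpD ?dvdn_mulr.
- move=> a b; rewrite -exprD -mulnDr; apply: (prim_expr_eq qP mg).
  by rewrite val_ZpD ?dvdn_mull.
(* Here the exponent [x] may be replaced by [f x], which agrees with it modulo [m]. *)
- move=> _ /imsetP[x _ ->]; rewrite uf -exprM mulnC.
  exact/esym/(prim_expr_eq qP mg).
Qed.

End RuzsaSet.

Theorem theorem3p1 (g p : nat) (hg : 0 < g) (hp : prime p)
    (hpg : p = 1 %[mod g]) :
  exists A : {set 'Z_((p ^ 2 - p) %/ g)},
    #|A| = p - 1 /\ is_Bhg 2 g A.
Proof.
have g_dvd : g %| p.-1 by rewrite -subn1 -eqn_mod_dvd ?prime_gt0 //; apply/eqP.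
have -> : (p ^ 2 - p) %/ g = p * (p.-1 %/ g).
  by rewrite muln_divA // -subn1 mulnBr muln1 mulnn.
by rewrite subn1; apply: exists_B2g => //; rewrite divnK.
Qed.
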